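(* Let $d,n\ge2$, $m>0$, $\beta>0$, and let $Z_{\mathcal X}$ be the partition function of the Gaussian free field without boundary on the Hamming graph $\mathcal X=\{0,1,\ldots,n-1\}^d$ with mass $m$, inverse temperature $\beta$ and interaction weights $J_1,\ldots,J_d$, as defined in the context. Then $$Z_{\mathcal X}=\left(\frac{2\pi}\beta\right)^{n^d/2}\frac1m\prod_{i=1}^d(1+m^2-\lambda_i)^{-\kappa_i/2},$$ where $\lambda_i$ are the eigenvalues defined in the context and $\kappa_i=\binom di(n-1)^i$.
   Context: $\rho(x,x')=|\{i:x_i\ne x_i'\}|$ is the Hamming distance; $R_i=\{(x,x')\in\mathcal X\times\mathcal X:\rho(x,x')=i\}$ (ordered pairs). Weights $J_i\ge0$, $i=1,\ldots,d$, satisfy $\sum_{i=1}^d\kappa_iJ_i\le1$. The Hamiltonian is $H\{(\xi_x)\}=\frac14\sum_{i=1}^dJ_i\sum_{(x,x')\in R_i}(\xi_x-\xi_{x'})^2+\frac{m^2}2\sum_{x\in\mathcal X}\xi_x^2$; the partition function is $Z_{\mathcal X}=\int_{\mathbb R^{\mathcal X}}e^{-\beta H\{(\xi_x)\}}\prod_{x\in\mathcal X}d\xi_x$. Put $w_i=\kappa_iJ_i$ for $1\le i\le d$, $w_0=1-\sum_{i=1}^dw_i$, and $$\lambda_i=\sum_{j=0}^d\frac{w_j}{\kappa_j}K_j(i),\qquad K_i(j)=\sum_{l=\max(0,i+j-d)}^{\min(i,j)}(-1)^l(n-1)^{i-l}\binom jl\binom{d-j}{i-l}$$ (Krawtchouk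 polynomials). These are the eigenvalues of the stochastic matrix $(P)_{x,x'}=w_{\rho(x,x')}/\kappa_{\rho(x,x')}$ on $\mathcal X$. *)

(* Defs.v *)
From HB Require Import structures.
From mathcomp Require Import all_boot all_order all_algebra.
From mathcomp Require Import all_classical all_reals all_analysis.
Set Implicit Arguments.
Unset Strict Implicit.
Unset Printing Implicit Defensive.
Import Order.TTheory GRing.Theory Num.Theory.
Local Open Scope ring_scope.

Section product_measure_tuple.
Context {d : measure_display} {T : measurableType d} {R : realType}.
Local Open Scope classical_set_scope.
Local Open Scope ereal_scope.

Definition tcons (N : nat) (p : T * N.-tuple T) : N.+1.-tuple T :=
  [tuple of p.1 :: p.2].

Lemma measurable_tcons (N : nat) : measurable_fun [set: _] (@tcons N).
Proof. by apply: measurable_cons. Qed.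

HB.instance Definition _ (N : nat) :=
  isMeasurableFun.Build _ _ _ _ (@tcons N) (@measurable_tcons N).

Section step.
Variables (N : nat) (m : {sigma_finite_measure set T -> \bar R}).
Variable mu : {sigma_finite_measure set (N.-tuple T) -> \bar R}.

Definition product_measure_tcons : set (N.+1.-tuple T) -> \bar R :=
  pushforward (m \x mu) (@tcons N).

Let step0 : product_measure_tcons set0 = 0.
Proof. exact: measure0. Qed.

Let step_ge0 A : 0 <= product_measure_tcons A.
Proof. exact: measure_ge0. Qed.

Let step_sigma_additive : semi_sigma_additive product_measure_tcons.
Proof. exact: measure_semi_sigma_additive. Qed.

HB.instance Definition _ := isMeasure.Build _ _ _ product_measure_tcons
  step0 step_ge0 step_sigma_additive.

Lemma sigma_finite_product_measure_tcons :
  sigma_finite [set: N.+1.-tuple T] product_measure_tcons.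
Proof.
have /sigma_finiteP[F [FT ndF Foo]] := sigma_finiteT m.
have /sigma_finiteP[G [GT ndG Goo]] := sigma_finiteT mu.
exists (fun k => [set t | F k (thead t) /\ G k [tuple of behead t]]).
  apply/seteqP; split=> // t _.
  have [i _ Fi] : (\bigcup_i F i) (thead t) by rewrite -FT.
  have [j _ Gj] : (\bigcup_i G i) [tuple of behead t] by rewrite -GT.
  exists (maxn i j) => //; split.
    by apply: (subsetPset _ _ (ndF _ _ _)) Fi; exact: leq_maxl.
  by apply: (subsetPset _ _ (ndG _ _ _)) Gj; exact: leq_maxr.
move=> k; have [mF Fk] := Foo k; have [mG Gk] := Goo k; split.
  apply: measurableI; rewrite -[X in measurable X]setTI.
    exact: measurable_tnth.
  exact: measurable_behead.
rewrite /product_measure_tcons /pushforward (_ : _ @^-1` _ = F k `*` G k).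
  by rewrite product_measure1E// lte_mul_pinfty// ge0_fin_numE.
apply/seteqP; split=> -[x t] /= [Fx Gt]; split=> //.
  by rewrite (_ : t = [tuple of behead (tcons (x, t))])//; exact/val_inj.
by rewrite (_ : [tuple of _] = t)//; exact/val_inj.
Qed.

HB.instance Definition _ := Measure_isSigmaFinite.Build _ _ _
  product_measure_tcons sigma_finite_product_measure_tcons.

End step.

(* N-fold product of m, on the product sigma-algebra of N.-tuple T. *)
Fixpoint product_measure_tuple (m : {sigma_finite_measure set T -> \bar R})
    (N : nat) : {sigma_finite_measure set (N.-tuple T) -> \bar R} :=
  match N with
  | 0 => \d_[tuple]
  | N'.+1 => product_measure_tcons m (product_measure_tuple m N')
  end.

Lemma product_measure_tuple_box (m : {sigma_finite_measure set T -> \bar R})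
    (N : nat) (A : 'I_N -> set T) :
  (forall i, measurable (A i)) ->
  product_measure_tuple m N [set t : N.-tuple T | forall i, A i (tnth t i)] =
  \prod_(i < N) m (A i).
Proof.
elim: N A => [|N IH] A mA.
  by rewrite big_ord0 /= diracE mem_set// => -[].
rewrite big_ord_recl -IH // -product_measure1E//=; last first.
  rewrite (_ : mkset _ = \bigcap_(i : 'I_N)
    (@tnth N T ^~ i) @^-1` A (lift ord0 i)); last first.
    by apply/seteqP; split=> [t h i _|t h i]; [exact: h|exact: (h i I)].
  apply: fin_bigcap_measurable => // i _.
  by rewrite -[_ @^-1` _]setTI; apply: measurable_tnth.
congr product_measure1; apply/seteqP; split=> [[x t]/= h|[x t]/= [h0 h] i].
  split; first exact: (h ord0).
  by move=> i; have := h (lift ord0 i); rewrite tnthS.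
have [j ->|->] := unliftP ord0 i; first by rewrite tnthS.
exact: h0.
Qed.

End product_measure_tuple.

Definition lebesgue_tuple {R : realType} (N : nat) :
    set (N.-tuple (measurableTypeR R)) -> \bar R :=
  product_measure_tuple (@lebesgue_measure R) N.

HB.instance Definition _ {R : realType} (N : nat) :=
  SigmaFiniteMeasure.on (@lebesgue_tuple R N).

Section hamming.
Variables d n : nat.

Definition hamming_space := {ffun 'I_d -> 'I_n}.

Definition hamming_dist (x y : hamming_space) : nat :=
  #|[set i : 'I_d | x i != y i]|.

Definition hamming_rel (i : nat) : {set hamming_space * hamming_space} :=
  [set p | hamming_dist p.1 p.2 == i].

Definition kappa (i : nat) : nat := ('C(d, i) * n.-1 ^ i)%N.

Variable R : realType.

(* Truncated subtraction makes the lower bound i + j - d equal to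
   max(0, i + j - d). *)
Definition krawtchouk (i j : nat) : R :=
  \sum_((i + j - d)%N <= l < (minn i j).+1)
     (-1) ^+ l * (n.-1 ^ (i - l) * 'C(j, l) * 'C(d - j, i - l))%N%:R.

Variable J : nat -> R.

Definition weight (i : nat) : R :=
  if i is 0 then 1 - \sum_(1 <= j < d.+1) (kappa j)%:R * J j
  else (kappa i)%:R * J i.

Definition eigenval (i : nat) : R :=
  \sum_(0 <= j < d.+1) weight j / (kappa j)%:R * krawtchouk j i.

Definition hamiltonian (m : R) (xi : hamming_space -> R) : R :=
  4^-1 * \sum_(1 <= i < d.+1)
           J i * \sum_(p in hamming_rel i) (xi p.1 - xi p.2) ^+ 2
  + m ^+ 2 / 2 * \sum_x xi x ^+ 2.

(* R^X is modelled by #|X|.-tuple R, coordinates being indexed through the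
   enumeration of the finite type X. *)
Definition partition_function (m beta : R) : \bar R :=
  \int[@lebesgue_tuple R #|{: hamming_space}|]_t
    (expR (- beta * hamiltonian m (fun x => tnth t (enum_rank x))))%:E.

End hamming.

(* Main.v *)
Require Import Defs.
From mathcomp Require Import all_boot all_order all_algebra.
From mathcomp Require Import all_classical all_reals all_analysis.
From mathcomp Require Import measurable_realfun zify ring.
Import Order.TTheory GRing.Theory Num.Theory.
Local Open Scope ring_scope.

(* The Hamiltonian is half the quadratic form of (1 + m^2) I - P, which is
   positive definite because the interactions are nonnegative, so the partition
   function is a Gaussian integral; such an integral is computed by completing
   the square in one variable at a time, the remaining form being given by the
   Schur complement.
   The determinant is found by exhibiting a real eigenbasis of P. Any basis
   u_0 = 1, u_1, ..., u_(n-1) of R^n in which u_k has coordinate sum 0 for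
   k > 0 diagonalizes the all-ones matrix, hence its d-fold tensor power
   diagonalizes simultaneously the adjacency matrices A_j of all the relations
   R_j: since \sum_j A_j X^j is the d-fold tensor power of I + X (ones - I), the
   eigenvalue of A_j at the basis vector indexed by y is the coefficient of X^j
   in (1 - X)^|y| (1 + (n-1) X)^(d-|y|), that is K_j(|y|), where |y| is the
   number of nonzero coordinates of y. *)

(** * Preliminaries on finite sums and products *)

Lemma big_enum_valT (S : Type) (idx : S) (op : Monoid.com_law idx)
    (T : finType) (F : T -> S) :
  \big[op/idx]_x F x = \big[op/idx]_(i < #|T|) F (enum_val i).
Proof. by rewrite (reindex (@enum_val T T)) //; exact/onW_bij/enum_val_bij. Qed.

Lemma powR_prod (R : realType) (I : Type) (r : seq I) (P : pred I)
    (F : I -> R) (a : R) :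
  (forall i, 0 <= F i) ->
  (\prod_(i <- r | P i) F i) `^ a = \prod_(i <- r | P i) F i `^ a.
Proof.
move=> F0; elim: r => [|i r IH]; first by rewrite !big_nil powR1.
by rewrite !big_cons; case: (P i) => //; rewrite powRM ?IH ?prodr_ge0.
Qed.

(** * Gaussian integrals of positive definite quadratic forms *)

Section gaussian_integral.
Context {R : realType}.

Definition qform {N : nat} (M : 'M[R]_N) (u : 'I_N -> R) : R :=
  \sum_i \sum_j M i j * u i * u j.

Definition posdef {N : nat} (M : 'M[R]_N) : Prop :=
  forall u : 'I_N -> R, (exists i, u i != 0) -> 0 < qform M u.

Definition schur {N : nat} (M : 'M[R]_N.+1) : 'M[R]_N :=
  \matrix_(i, j) (M (lift ord0 i) (lift ord0 j)
                  - M (lift ord0 i) ord0 * M ord0 (lift ord0 j) / M ord0 ord0).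

(** By symmetry, row 0 and column 0 contribute the same cross term b u_0, so the square in u_0 can
    be completed; the leftover -b^2/a is the correction in [schur M]. *)
Lemma qform_schur {N : nat} (M : 'M[R]_N.+1) (u : 'I_N.+1 -> R) :
  M ord0 ord0 != 0 -> (forall i j, M i j = M j i) ->
  qform M u =
  M ord0 ord0 * (u ord0 +
    (\sum_j M ord0 (lift ord0 j) * u (lift ord0 j)) / M ord0 ord0) ^+ 2
  + qform (schur M) (fun i => u (lift ord0 i)).
Proof.
move=> a0 Msym; set a := M ord0 ord0; set b := \sum_j _.
rewrite /qform big_ord_recl big_ord_recl -/a.
under eq_bigr do rewrite mulrAC.
rewrite -mulr_suml -/b.
under [X in _ + X = _]eq_bigr do rewrite big_ord_recl.
rewrite big_split /=.
under [X in _ + (X + _) = _]eq_bigr do rewrite Msym.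
rewrite -mulr_suml -/b.
have -> : \sum_i \sum_j schur M i j * u (lift ord0 i) * u (lift ord0 j) =
  \sum_i \sum_j M (lift ord0 i) (lift ord0 j) * u (lift ord0 i)
                 * u (lift ord0 j) - b * b / a.
  rewrite {1}/b mulr_suml mulr_suml -sumrB; apply: eq_bigr => i _.
  rewrite mulrAC /b mulr_sumr -sumrB; apply: eq_bigr => j _.
  by rewrite mxE (Msym _ ord0) -/a; ring.
by field.
Qed.

(** Block Gaussian elimination: [M] is a unit lower block triangular matrix times an upper one with
    diagonal blocks [M ord0 ord0] and [schur M]. *)
Lemma det_schur {N : nat} (M : 'M[R]_N.+1) : M ord0 ord0 != 0 ->
  \det M = M ord0 ord0 * \det (schur M).
Proof.
move=> a0; pose M' : 'M[R]_(1 + N) := M.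
have E : M = block_mx 1%:M 0 ((M ord0 ord0)^-1 *: dlsubmx M') 1%:M *m
    block_mx (ulsubmx M') (ursubmx M') 0 (schur M) :> 'M[R]_(1 + N); last first.
  rewrite {1}E det_mulmx (det_lblock (1%:M : 'M[R]_1))
    (det_ublock (ulsubmx M')).
  by rewrite !det1 !mul1r det_mx11 !mxE !lshift0.
rewrite mulmx_block !mul1mx !mul0mx !addr0 -[LHS](@submxK _ 1 N 1 N).
congr block_mx; apply/matrixP => i j.
  have aK x : x = (M ord0 ord0)^-1 * x * M ord0 ord0 by field.
  by rewrite !mxE big_ord1 !mxE !rshift1 (ord1 j) !lshift0; exact: aK.
have aK x y z : x = (M ord0 ord0)^-1 * y * z + (x - y * z / M ord0 ord0).
  by field.
by rewrite !mxE big_ord1 !mxE !rshift1 !lshift0; exact: aK.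
Qed.

Lemma posdef_schur {N : nat} (M : 'M[R]_N.+1) : (forall i j, M i j = M j i) ->
  posdef M -> 0 < M ord0 ord0 /\ posdef (schur M).
Proof.
move=> Msym Mpos.
have a0 : 0 < M ord0 ord0.
  have := Mpos (fun i => (i == ord0)%:R) (ex_intro _ ord0 (oner_neq0 R)).
  rewrite /qform (bigD1 ord0) //= [X in _ + X]big1 ?addr0; last first.
    by move=> i /negPf ->; rewrite big1 // => j _; rewrite mulr0 mul0r.
  rewrite (bigD1 ord0) //= [X in _ + X]big1 ?addr0 ?mulr1 //.
  by move=> i /negPf ->; rewrite mulr0.
split=> // u [i ui].
(* This first coordinate makes the completed square vanish, so the form of [M] at [v] is that of
   [schur M] at [u]. *)
pose c := - (\sum_j M ord0 (lift ord0 j) * u j) / M ord0 ord0.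
pose v k := if unlift ord0 k is Some j then u j else c.
have vl j : v (lift ord0 j) = u j by rewrite /v liftK.
have := Mpos v (ex_intro _ (lift ord0 i) _); rewrite vl => /(_ ui).
rewrite qform_schur ?gt_eqF //.
under eq_bigr do rewrite vl.
rewrite {1}/v unlift_none /c mulNr addNr expr0n mulr0 add0r.
by congr (0 < _); apply: eq_bigr => k _; apply: eq_bigr => l _; rewrite !vl.
Qed.

Lemma schur_sym {N : nat} (M : 'M[R]_N.+1) : (forall i j, M i j = M j i) ->
  forall i j, schur M i j = schur M j i.
Proof.
move=> Msym i j; rewrite !mxE (Msym (lift ord0 i) (lift ord0 j)).
by rewrite (Msym (lift ord0 i) ord0) (Msym (lift ord0 j) ord0) (mulrC (M _ _)).
Qed.

(** The integrand is the normal density of mean -c and standard deviation a^(-1/2), divided by its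
    peak value. *)
Lemma integral_gauss1 (a c : R) : 0 < a ->
  (\int[@lebesgue_measure R]_x (expR (- 2^-1 * (a * (x + c) ^+ 2)))%:E)%E =
  ((2 * pi) `^ 2^-1 * a `^ (- 2^-1))%:E.
Proof.
move=> a0.
have s0 : Num.sqrt a^-1 != 0 by rewrite gt_eqF // sqrtr_gt0 invr_gt0.
have sq : Num.sqrt a^-1 ^+ 2 = a^-1 by rewrite sqr_sqrtr // invr_ge0 ltW.
have -> : (2 * pi) `^ 2^-1 * a `^ (- 2^-1) =
    (normal_peak (Num.sqrt a^-1))^-1.
  have pi0 : 0 <= 2 * pi :> R by rewrite mulr_ge0 // pi_ge0.
  rewrite /normal_peak invrK sq powRN (powR12_sqrt (ltW a0)) (powR12_sqrt pi0).
  rewrite -sqrtrV ?ltW // -sqrtrM ?mulr_ge0 ?pi_ge0 //; congr Num.sqrt.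
  by rewrite -mulr_natl; ring.
rewrite -[RHS]mule1 -(integral_normal_pdf (- c) (Num.sqrt a^-1)).
rewrite -ge0_integralZl_EFin //; last 3 first.
- by move=> x _; rewrite lee_fin normal_pdf_ge0.
- by apply/measurable_EFinP; exact: measurable_normal_pdf.
- by rewrite invr_ge0 normal_peak_ge0.
apply: eq_integral => x _; rewrite -EFinM normal_pdfE //= [in RHS]mulrA.
rewrite mulVf ?mul1r; last first.
  by rewrite gt_eqF // normal_peak_gt0.
congr (_%:E); rewrite /normal_fun sq opprK; congr expR.
by rewrite -mulr_natl; field; rewrite gt_eqF.
Qed.

Lemma measurable_gauss {N : nat} (M : 'M[R]_N) :
  measurable_fun [set: N.-tuple (measurableTypeR R)]
    (fun t => (expR (- 2^-1 * qform M (fun i => tnth t i)))%:E).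
Proof.
apply/measurable_EFinP/measurableT_comp => //=; apply: measurable_funM => //=.
rewrite /qform; apply: measurable_sum => i; apply: measurable_sum => j.
apply: measurable_funM => //; last exact: measurable_tnth.
by apply: measurable_funM => //; exact: measurable_tnth.
Qed.

(** Positivity of the determinant is carried through the induction because [powRM] splits a power
    only over nonnegative factors. *)
Lemma integral_gauss {N : nat} (M : 'M[R]_N) : (forall i j, M i j = M j i) ->
  posdef M ->
  0 < \det M /\
  (\int[@lebesgue_tuple R N]_t
    (expR (- 2^-1 * qform M (fun i => tnth t i)))%:E)%E =
  ((2 * pi) `^ (N%:R / 2) * (\det M) `^ (- 2^-1))%:E.
Proof.
elim: N M => [|N IH] M Msym Mpos.
  rewrite det_mx00 ltr01; split=> //.
  rewrite integral_dirac // ?diracT ?mul1e; last exact: measurable_gauss.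
  by rewrite mul0r powRr0 powR1 mul1r /qform big_ord0 mulr0 expR0.
have [a0 Spos] := posdef_schur _ Msym Mpos.
have [d0 IHS] := IH _ (schur_sym _ Msym) Spos.
rewrite det_schur ?gt_eqF //; split; first exact: mulr_gt0.
transitivity (\int[pushforward (lebesgue_measure \x @lebesgue_tuple R N)%E
   (@tcons _ (measurableTypeR R) N)]_t
   (expR (- 2^-1 * qform M (fun i => tnth t i)))%:E)%E; first by [].
rewrite ge0_integral_pushforward //; last exact: measurable_gauss.
rewrite preimage_setT fubini_tonelli2; last 2 first.
- by apply: (measurableT_comp (measurable_gauss M)); exact: measurable_tcons.
- by move=> x; rewrite lee_fin.
(* For a fixed tail [t], [c t] is the shift in the completed square; the integral [K] over the head
   does not depend on [t]. *)
pose c (t : N.-tuple R) :=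
  (\sum_j M ord0 (lift ord0 j) * tnth t j) / M ord0 ord0.
pose K := (2 * pi) `^ 2^-1 * M ord0 ord0 `^ (- 2^-1).
have K0 : 0 <= K by rewrite mulr_ge0 ?powR_ge0.
transitivity (\int[@lebesgue_tuple R N]_t
  (K%:E * (expR (- 2^-1 * qform (schur M) (fun i => tnth t i)))%:E))%E.
  apply: eq_integral => t _; rewrite /fubini_G /=.
  rewrite -(integral_gauss1 _ (c t) a0) -ge0_integralZr //.
  - apply: eq_integral => x _; rewrite -EFinM -expRD -mulrDr.
    congr ((expR (_ * _))%:E).
    rewrite qform_schur ?gt_eqF //; congr (_ * (_ + _ / _) ^+ 2 + _).
      by apply: eq_bigr => j _; rewrite tnthS.
    by apply: eq_bigr => i _; apply: eq_bigr => j _; rewrite !tnthS.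
  - apply/measurable_EFinP/measurableT_comp => //; apply: measurable_funM => //.
    apply: measurable_funM => //; apply: measurable_funX.
    exact: measurable_funD.
rewrite ge0_integralZl_EFin //; last exact: measurable_gauss.
rewrite IHS -EFinM /K (powRM _ (ltW a0) (ltW d0)); congr (_%:E).
have -> : (2 * pi) `^ (N.+1%:R / 2) =
    (2 * pi) `^ 2^-1 * (2 * pi) `^ (N%:R / 2) :> R.
  rewrite -powRD; last by rewrite implybE mulf_neq0 ?orbT ?gt_eqF ?pi_gt0.
  by congr (_ `^ _); rewrite -natr1; ring.
by ring.
Qed.

End gaussian_integral.

(** As matrices, f V = V D with D the diagonal matrix of [ev]; the determinants of V and of its
    inverse W cancel. *)
Lemma det_eigenbasis (F : fieldType) (T : finType) (f V W : T -> T -> F)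
    (ev : T -> F) :
  (forall x y, \sum_z f x z * V z y = V x y * ev y) ->
  (forall x y, \sum_z V x z * W z y = (x == y)%:R) ->
  \det (\matrix_(i < #|T|, j < #|T|) f (enum_val i) (enum_val j)) =
  \prod_x ev x.
Proof.
move=> fV VW.
pose mx (g : T -> T -> F) :=
  \matrix_(i < #|T|, j < #|T|) g (enum_val i) (enum_val j).
have mxM g h : mx g *m mx h = mx (fun x y => \sum_z g x z * h z y).
  apply/matrixP => i j; rewrite !mxE [RHS]big_enum_valT.
  by apply: eq_bigr => k _; rewrite !mxE.
have VW1 : mx V *m mx W = 1%:M.
  by rewrite mxM; apply/matrixP => i j; rewrite !mxE VW (inj_eq enum_val_inj).
pose D := diag_mx (\row_(i < #|T|) ev (enum_val i)).
have fVD : mx f *m mx V = mx V *m D.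
  by rewrite mxM mul_mx_diag; apply/matrixP => i j; rewrite !mxE fV.
rewrite -/(mx f) -[LHS]mulr1 -(det1 F #|T|) -VW1 -det_mulmx mulmxA fVD.
rewrite !det_mulmx mulrAC -det_mulmx VW1 det1 mul1r det_diag.
by rewrite [RHS]big_enum_valT; apply: eq_bigr => i _; rewrite mxE.
Qed.

(** * A tensor eigenbasis with Krawtchouk eigenvalues *)

(* From here to the main theorem, n stands for the alphabet size minus one. *)
Section krawtchouk_eigenbasis.
Context {R : realType} {d n : nat}.
Local Notation X := (hamming_space d n.+1).

Definition hweight (y : X) : nat := hamming_dist [ffun=> ord0] y.

Lemma hamming_distE (x y : X) : hamming_dist x y = (\sum_i (x i != y i))%N.
Proof.
rewrite /hamming_dist -sum1dep_card big_mkcond.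
by apply: eq_bigr => i _; case: ifP.
Qed.

Lemma hamming_distC (x y : X) : hamming_dist x y = hamming_dist y x.
Proof. by rewrite !hamming_distE; apply: eq_bigr => i _; rewrite eq_sym. Qed.

Lemma hamming_dist_le (x y : X) : (hamming_dist x y <= d)%N.
Proof. by rewrite -[leqRHS]card_ord max_card. Qed.

(** Column k is u_k: the all-ones vector for k = 0, and e_k - e_0 otherwise. The entries are
    integers, so no complex characters enter. *)
Definition ones_basis (a k : 'I_n.+1) : R :=
  if k == ord0 then 1 else (a == k)%:R - (a == ord0)%:R.

(** Coordinates of e_b in the basis u_k: a vector has its mean as coefficient of u_0, and its k-th
    entry minus the mean as coefficient of u_k. *)
Definition ones_dual (k b : 'I_n.+1) : R :=
  if k == ord0 then n.+1%:R^-1 else (k == b)%:R - n.+1%:R^-1.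

Lemma sum_eq_op (a : 'I_n.+1) : \sum_k (a == k)%:R = 1 :> R.
Proof.
rewrite (bigD1 a) //= eqxx big1 ?addr0 // => k.
by rewrite eq_sym => /negPf ->.
Qed.

Lemma ones_basis_dual (a b : 'I_n.+1) :
  \sum_k ones_basis a k * ones_dual k b = (a == b)%:R.
Proof.
have n0 : (n.+1%:R : R) != 0 by rewrite pnatr_eq0.
rewrite big_ord_recl /ones_basis /ones_dual /= mul1r.
have [->|a0] := eqVneq a ord0.
  under eq_bigr do rewrite -[ord0 == lift _ _]/false sub0r mulN1r opprB.
  rewrite sumrB sumr_const card_ord.
  have := sum_eq_op b; rewrite big_ord_recl => /(canRL (addKr _)).
  under eq_bigr do rewrite eq_sym.
  move=> ->; rewrite (eq_sym b) -mulr_natl.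
  by field.
under eq_bigr do rewrite subr0.
have [j ->|aE] := unliftP ord0 a; last by rewrite aE eqxx in a0.
rewrite (bigD1 j) //= eqxx mul1r big1; last first.
  by move=> k; rewrite (inj_eq lift_inj) eq_sym => /negPf ->; rewrite mul0r.
by rewrite addr0 addrC subrK.
Qed.

Lemma sum_ones_basis (k : 'I_n.+1) :
  \sum_a ones_basis a k = if k == ord0 then n.+1%:R else 0.
Proof.
rewrite /ones_basis; case: ifP => _; first by rewrite sumr_const card_ord.
have sumE (b : 'I_n.+1) : \sum_a (a == b)%:R = 1 :> R.
  by rewrite -[RHS](sum_eq_op b); apply: eq_bigr => a _; rewrite eq_sym.
by rewrite sumrB !sumE subrr.
Qed.

Definition hbasis (x y : X) : R := \prod_i ones_basis (x i) (y i).
Definition hdual (x y : X) : R := \prod_i ones_dual (x i) (y i).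

Lemma hbasis_dual (x y : X) : \sum_z hbasis x z * hdual z y = (x == y)%:R.
Proof.
transitivity (\prod_i ((x i == y i)%:R : R)).
  rewrite -(eq_bigr _ (fun i _ => ones_basis_dual (x i) (y i))) bigA_distr_bigA.
  by apply: eq_bigr => z _; rewrite -big_split.
have [->|xy] := eqVneq x y; first by rewrite big1 // => i _; rewrite eqxx.
apply/eqP/prodf_eq0; have /existsP[i /negPf xyi] : [exists i, x i != y i].
  rewrite -negb_forall; apply: contra xy => /forallP h.
  by apply/eqP/ffunP => i; apply/eqP.
by exists i => //; rewrite xyi.
Qed.

(** Shows that every eigenvector is nonzero, for use in [coupling_eigenval_gt0]. *)
Lemma hbasis_diag (y : X) : hbasis y y = 1 :> R.
Proof.
rewrite /hbasis big1 // => i _; rewrite /ones_basis.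
by case: ifPn => // /negPf ->; rewrite eqxx subr0.
Qed.

Lemma coef_1DX_exp (c : R) (s l : nat) :
  ((1 + c *: 'X) ^+ s)`_l = c ^+ l * 'C(s, l)%:R.
Proof.
rewrite exprDn coef_sum.
under eq_bigr do rewrite expr1n mul1r exprZn coefMn coefZ coefXn.
have [ls|sl] := ltnP l s.+1; last first.
  rewrite bin_small // mulr0 big1 // => i _.
  by rewrite gtn_eqF ?mulr0 ?mul0rn // (leq_trans (ltn_ord i)).
rewrite (bigD1 (Ordinal ls)) //= eqxx mulr1 big1 ?addr0 ?mulr_natr // => i.
by rewrite -(inj_eq val_inj) eq_sym => /negPf /= ->; rewrite mulr0 mul0rn.
Qed.

(** The Cauchy product gives the same summand over the wider range 0 <= l <= j; the additional terms
    vanish. *)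
Lemma krawtchouk_coef (j s : nat) : (j <= d)%N -> (s <= d)%N ->
  krawtchouk d n.+1 R j s =
  ((1 - 'X) ^+ s * (1 + n%:R *: 'X) ^+ (d - s) : {poly R})`_j.
Proof.
move=> jd sd; pose F l : R :=
  (-1) ^+ l * 'C(s, l)%:R * (n%:R ^+ (j - l) * 'C(d - s, j - l)%:R).
transitivity (\sum_(0 <= l < j.+1) F l); last first.
  rewrite coefM big_mkord; apply: eq_bigr => l _.
  by rewrite /F -!coef_1DX_exp scaleN1r.
(* Here l > s, so C(s, l) = 0. *)
rewrite [RHS](@big_cat_nat _ _ _ (minn j s).+1) //=; last first.
  by rewrite ltnS geq_minl.
rewrite [X in _ = _ + X]big_nat [X in _ = _ + X]big1 ?addr0; last first.
  move=> l ljs; rewrite /F bin_small ?mulr0 ?mul0r //; lia.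
(* Here l < j + s - d, so j - l > d - s and C(d - s, j - l) = 0. *)
rewrite [RHS](@big_cat_nat _ _ _ (j + s - d)%N) //=; last by lia.
rewrite [X in _ = X + _]big_nat [X in _ = X + _]big1 ?add0r; last first.
  move=> l ljs; rewrite /F (@bin_small (d - s)) ?mulr0 //; lia.
by apply: eq_bigr => l _; rewrite /F !natrM natrX; ring.
Qed.

(** The one-letter matrix is X ones + (1 - X) I, and the all-ones matrix multiplies u_0 by n + 1 and
    kills the other u_k. *)
Lemma sum_coord_basis (b k : 'I_n.+1) :
  \sum_a ('X ^+ (b != a) * (ones_basis a k)%:P) =
  (ones_basis b k)%:P * (if k == ord0 then 1 + n%:R *: 'X else 1 - 'X)
  :> {poly R}.
Proof.
have E a : 'X ^+ (b != a) * (ones_basis a k)%:P =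
    'X * (ones_basis a k)%:P + (1 - 'X) * ((b == a)%:R * ones_basis a k)%:P
    :> {poly R}.
  by case: eqVneq => _; rewrite /= ?mul1r ?mul0r ?expr0 ?expr1; ring.
rewrite (eq_bigr _ (fun a _ => E a)) big_split -!mulr_sumr -!raddf_sum /=.
rewrite sum_ones_basis.
rewrite [X in _ + _ * X%:P](bigD1 b) //= eqxx mul1r big1 ?addr0; last first.
  by move=> a; rewrite eq_sym => /negPf ->; rewrite mul0r.
rewrite /ones_basis; case: ifP => _.
  by rewrite -mul_polyC -natr1 polyCD polyC1; ring.
by rewrite polyC0 mulr0 add0r mulrC.
Qed.

(* Both sides are the coefficients of X^j in
   \prod_i \sum_a X^[x_i <> a] u_(a, y_i). *)
Lemma sum_sphere_hbasis (j : nat) (x y : X) : (j <= d)%N ->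
  \sum_(z | hamming_dist x z == j) hbasis z y =
  hbasis x y * krawtchouk d n.+1 R j (hweight y).
Proof.
move=> jd; have yd := hamming_dist_le [ffun=> ord0] y.
rewrite krawtchouk_coef // -coefCM /hbasis rmorph_prod /=.
have -> : (1 - 'X) ^+ hweight y * (1 + n%:R *: 'X) ^+ (d - hweight y) =
    \prod_i (if y i == ord0 then 1 + n%:R *: 'X else 1 - 'X : {poly R}).
  have -> : (d - hweight y = \sum_i (y i == ord0))%N.
    apply/eqP; rewrite -(eqn_add2r (hweight y)) subnK // /hweight hamming_distE.
    rewrite -big_split /= -[X in X == _]muln1 -[X in (X * _)%N]card_ord.
    rewrite -sum_nat_const.
    by apply/eqP/eq_bigr => i _; rewrite ffunE eq_sym; case: eqP.
  rewrite /hweight hamming_distE -!prodrXr -big_split; apply: eq_bigr => i _ /=.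
  by rewrite ffunE eq_sym; case: eqP => _; rewrite ?mulr1 ?mul1r.
rewrite -big_split /=.
rewrite -(eq_bigr _ (fun i _ => sum_coord_basis (x i) (y i))) bigA_distr_bigA.
rewrite coef_sum big_mkcond; apply: eq_bigr => z _.
rewrite big_split /= -rmorph_prod prodrXr -hamming_distE mulrC.
rewrite coefCM coefXn eq_sym.
by case: eqP => _; rewrite ?mulr1 ?mulr0.
Qed.

End krawtchouk_eigenbasis.

(** * Sphere sizes, the matrix P and its eigenvalues *)

Section free_field.
Context {R : realType} {d n : nat}.
Local Notation X := (hamming_space d n.+1).
Local Notation origin := ([ffun=> ord0] : X).

Lemma krawtchouk0 (j : nat) : (j <= d)%N ->
  krawtchouk d n.+1 R j 0 = (kappa d n.+1 j)%:R.
Proof.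
move=> jd; rewrite krawtchouk_coef // expr0 mul1r coef_1DX_exp subn0.
by rewrite natrM natrX mulrC.
Qed.

(** The basis vector indexed by the origin is constant 1, so its sum over a sphere counts the
    points, while its eigenvalue is K_j(0) = kappa_j. *)
Lemma card_sphere (x : X) (j : nat) : (j <= d)%N ->
  #|[pred y | hamming_dist x y == j]| = kappa d n.+1 j.
Proof.
move=> jd; apply/eqP; rewrite -(eqr_nat R); apply/eqP.
have w0 : hweight origin = 0%N.
  by rewrite /hweight hamming_distE big1 // => i _; rewrite ffunE eqxx.
have b0 z : hbasis z origin = 1 :> R.
  by rewrite /hbasis big1 // => i _; rewrite ffunE /ones_basis eqxx.
rewrite -krawtchouk0 // -w0 -[RHS]mul1r -(b0 x) -sum_sphere_hbasis //.
by rewrite -sumr_const; apply: eq_big => z; rewrite ?inE ?b0.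
Qed.

Variables (J : nat -> R) (m : R).

Definition transition (x y : X) : R :=
  weight d n.+1 J (hamming_dist x y) / (kappa d n.+1 (hamming_dist x y))%:R.

Lemma sum_transition (F : X -> R) (x : X) :
  \sum_y transition x y * F y =
  \sum_(0 <= j < d.+1) weight d n.+1 J j / (kappa d n.+1 j)%:R *
    \sum_(y | hamming_dist x y == j) F y.
Proof.
under [RHS]eq_bigr do rewrite mulr_sumr big_mkcond.
rewrite exchange_big /=; apply: eq_bigr => y _.
have dxy : (hamming_dist x y < d.+1)%N by exact: hamming_dist_le.
rewrite big_mkord (bigD1 (Ordinal dxy)) //= eqxx big1 ?addr0 // => j.
by rewrite -(inj_eq val_inj) eq_sym => /negPf /= ->.
Qed.

Lemma transition_hbasis (x y : X) :
  \sum_z transition x z * hbasis z y =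
  hbasis x y * eigenval d n.+1 J (hweight y).
Proof.
rewrite sum_transition /eigenval mulr_sumr; apply: eq_big_nat => j /andP[_ jd].
by rewrite sum_sphere_hbasis // mulrCA.
Qed.

Lemma kappa_neq0 (j : nat) : (0 < n)%N -> (j <= d)%N ->
  (kappa d n.+1 j)%:R != 0 :> R.
Proof.
by move=> n0 jd; rewrite pnatr_eq0 -lt0n muln_gt0 bin_gt0 jd expn_gt0 n0.
Qed.

(** K_j(0) = kappa_j cancels the denominators, leaving the sum of all weights, which is 1 by the
    choice of w_0. *)
Lemma eigenval0 : (0 < n)%N -> eigenval d n.+1 J 0 = 1.
Proof.
move=> n0; rewrite /eigenval.
transitivity (\sum_(0 <= j < d.+1) weight d n.+1 J j).
  apply: eq_big_nat => j /andP[_ jd].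
  by rewrite krawtchouk0 // divfK // kappa_neq0.
rewrite big_ltn //=.
rewrite -[X in _ + X = _](eq_big_nat _ _
  (F1 := fun j => (kappa d n.+1 j)%:R * J j)).
  by rewrite subrK.
by case.
Qed.

Definition coupling (x y : X) : R :=
  (1 + m ^+ 2) * (x == y)%:R - transition x y.

Lemma coupling_sym (x y : X) : coupling x y = coupling y x.
Proof.
by rewrite /coupling /transition eq_sym hamming_distC.
Qed.

Lemma sum_coupling (F : X -> R) (x : X) :
  \sum_y coupling x y * F y = (1 + m ^+ 2) * F x - \sum_y transition x y * F y.
Proof.
rewrite -(eq_bigr _ (fun y _ => esym (mulrBl _ _ _))) sumrB; congr (_ - _).
rewrite (bigD1 x) //= eqxx mulr1 big1 ?addr0 // => y.
by rewrite eq_sym => /negPf ->; rewrite mulr0 mul0r.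
Qed.

Lemma coupling_hbasis (x y : X) :
  \sum_z coupling x z * hbasis z y =
  hbasis x y * (1 + m ^+ 2 - eigenval d n.+1 J (hweight y)).
Proof. by rewrite sum_coupling transition_hbasis; ring. Qed.

(** * The Hamiltonian as a quadratic form *)

Lemma sum_hamming_rel (F : X -> X -> R) (j : nat) :
  \sum_(p in hamming_rel d n.+1 j) F p.1 p.2 =
  \sum_x \sum_(y | hamming_dist x y == j) F x y.
Proof. by rewrite pair_big_dep /=; apply: eq_bigl => p; rewrite inE. Qed.

(** Each point is the first entry of kappa_j pairs and the second entry of as many. *)
Lemma sum_sqrB_hamming_rel (xi : X -> R) (j : nat) : (j <= d)%N ->
  \sum_(p in hamming_rel d n.+1 j) (xi p.1 - xi p.2) ^+ 2 =
  2 * ((kappa d n.+1 j)%:R * \sum_x xi x ^+ 2) -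
  2 * \sum_x xi x * \sum_(y | hamming_dist x y == j) xi y.
Proof.
move=> jd.
have E1 : \sum_(p in hamming_rel d n.+1 j) xi p.1 ^+ 2 =
    (kappa d n.+1 j)%:R * \sum_x xi x ^+ 2.
  rewrite (sum_hamming_rel (fun x _ => xi x ^+ 2)) mulr_sumr.
  by apply: eq_bigr => x _; rewrite sumr_const card_sphere // mulr_natl.
have E2 : \sum_(p in hamming_rel d n.+1 j) xi p.2 ^+ 2 =
    (kappa d n.+1 j)%:R * \sum_x xi x ^+ 2.
  rewrite (sum_hamming_rel (fun _ x => xi x ^+ 2)).
  under eq_bigr do rewrite big_mkcond.
  rewrite exchange_big mulr_sumr; apply: eq_bigr => y _ /=.
  rewrite -big_mkcond sumr_const -(card_sphere y) // mulr_natl; congr (_ *+ _).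
  by apply: eq_card => x; rewrite !inE (hamming_distC y).
rewrite -[in RHS]E1 [X in X * _ - _](_ : 2 = 1 + 1) // mulrDl mul1r {2}E1 -E2.
rewrite -(eq_bigr _ (fun x _ => esym (mulr_sumr _ _ _ _))).
rewrite -(sum_hamming_rel (fun x y => xi x * xi y)) mulr_sumr.
rewrite -big_split -sumrB /=.
by apply: eq_bigr => p _; ring.
Qed.

(** The diagonal coefficient 1 + m^2 - w_0 is m^2 + \sum_i kappa_i J_i, as the mass term and the
    expanded squares require; off the diagonal, w_i / kappa_i = J_i. *)
Lemma hamiltonian_coupling (xi : X -> R) : (0 < n)%N ->
  hamiltonian J m xi =
  2^-1 * \sum_x \sum_y coupling x y * xi x * xi y.
Proof.
move=> n0; pose S j := \sum_x xi x * \sum_(y | hamming_dist x y == j) xi y.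
pose Q := \sum_x xi x ^+ 2.
have -> : \sum_x \sum_y coupling x y * xi x * xi y = (1 + m ^+ 2) * Q -
   \sum_(0 <= j < d.+1) weight d n.+1 J j / (kappa d n.+1 j)%:R * S j.
  rewrite /S; under [X in _ - X]eq_bigr do rewrite mulr_sumr.
  rewrite [X in _ - X]exchange_big /Q mulr_sumr -sumrB.
  apply: eq_bigr => x _ /=.
  under eq_bigr do rewrite mulrAC -mulrC.
  rewrite -mulr_sumr sum_coupling sum_transition mulrBr mulr_sumr.
  congr (_ - _); first by ring.
  by apply: eq_bigr => j _; rewrite mulrCA.
have S0 : S 0%N = Q.
  apply: eq_bigr => x _; rewrite expr2; congr (_ * _).
  rewrite (big_pred1 x) // => y /=; rewrite hamming_distE sum_nat_eq0.
  apply/forallP/eqP => [h|-> i]; last by rewrite eqxx.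
  by apply/ffunP => i; have := h i; rewrite eqb0 negbK => /eqP.
rewrite big_ltn // S0 /kappa bin0 expn0 muln1 divr1 /weight /hamiltonian -/Q.
have -> : \sum_(1 <= i < d.+1)
      J i * \sum_(p in hamming_rel d n.+1 i) (xi p.1 - xi p.2) ^+ 2 =
    2 * \sum_(1 <= i < d.+1) (kappa d n.+1 i)%:R * J i * Q
    - 2 * \sum_(1 <= i < d.+1) J i * S i.
  rewrite !mulr_sumr -sumrB; apply: eq_big_nat => i /andP[_ id].
  by rewrite sum_sqrB_hamming_rel // -/Q -/(S i); ring.
rewrite -mulr_suml.
have -> : \sum_(1 <= j < d.+1)
      (if j is 0 then 1 - \sum_(1 <= k < d.+1) (kappa d n.+1 k)%:R * J k
       else (kappa d n.+1 j)%:R * J j) / (kappa d n.+1 j)%:R * S j =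
    \sum_(1 <= i < d.+1) J i * S i.
  apply: eq_big_nat => -[//|j] /andP[_ jd].
  by congr (_ * _); rewrite mulrC mulKf // kappa_neq0.
by field.
Qed.

(** * Positivity and evaluation of the partition function *)

Hypotheses (n_gt0 : (0 < n)%N) (m_gt0 : 0 < m).
Hypothesis J_ge0 : forall i : nat, (1 <= i <= d)%N -> 0 <= J i.

(** In the Hamiltonian the interaction terms are nonnegative, and the mass term is positive at a
    nonzero field. *)
Lemma coupling_gt0 (xi : X -> R) : (exists x, xi x != 0) ->
  0 < \sum_x \sum_y coupling x y * xi x * xi y.
Proof.
move=> [x xi_x].
suff : 0 < hamiltonian J m xi.
  by rewrite hamiltonian_coupling // pmulr_rgt0 // invr_gt0.
apply: ltr_wpDl.
  rewrite mulr_ge0 ?invr_ge0 // big_nat sumr_ge0 // => i id.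
  by rewrite mulr_ge0 ?J_ge0 // sumr_ge0 // => p _; exact: sqr_ge0.
rewrite !mulr_gt0 ?exprn_gt0 ?invr_gt0 // (bigD1 x) //= ltr_wpDr //.
  by rewrite sumr_ge0 // => y _; exact: sqr_ge0.
by rewrite lt0r sqrf_eq0 xi_x sqr_ge0.
Qed.

(** At the eigenvector indexed by [y], the form is the eigenvalue times a positive sum of
    squares. *)
Lemma coupling_eigenval_gt0 (y : X) :
  0 < 1 + m ^+ 2 - eigenval d n.+1 J (hweight y).
Proof.
have b0 : exists x : X, hbasis x y != 0 :> R.
  by exists y; rewrite hbasis_diag oner_neq0.
have := coupling_gt0 (fun x => hbasis x y) b0.
under eq_bigr do under eq_bigr do rewrite mulrAC.
under eq_bigr do rewrite -mulr_suml coupling_hbasis mulrAC.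
rewrite -mulr_suml pmulr_rgt0 //; case: b0 => x bx.
rewrite (bigD1 x) //= ltr_wpDr //.
  by rewrite sumr_ge0 // => z _; rewrite -expr2 sqr_ge0.
by rewrite -expr2 lt0r sqrf_eq0 bx sqr_ge0.
Qed.

(** The weight is the distance to the origin, so [card_sphere] gives the multiplicities. *)
Lemma prod_hweight (g : nat -> R) :
  \prod_(y : X) g (hweight y) = \prod_(0 <= j < d.+1) g j ^+ kappa d n.+1 j.
Proof.
rewrite big_mkord (partition_big
  (fun y : X => Ordinal (hamming_dist_le origin y : (hweight y < d.+1)%N))
  xpredT) //=.
apply: eq_bigr => j _; rewrite -(card_sphere origin) -1?ltnS //.
rewrite -prodr_const; apply: eq_big => y; rewrite ?inE //=.
by move=> /eqP <-.
Qed.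

Lemma prod_coupling_eigenval :
  \prod_(y : X) (1 + m ^+ 2 - eigenval d n.+1 J (hweight y)) `^ (- 2^-1) =
  1 / m * \prod_(1 <= i < d.+1)
    (1 + m ^+ 2 - eigenval d n.+1 J i) `^ (- (kappa d n.+1 i)%:R / 2).
Proof.
rewrite (prod_hweight
  (fun i => (1 + m ^+ 2 - eigenval d n.+1 J i) `^ (- 2^-1))).
(* The factor i = 0 has exponent kappa_0 = 1 and base 1 + m^2 - 1 = m^2, whose power -1/2 is 1/m
   since m > 0. *)
rewrite big_ltn //; congr (_ * _).
  rewrite eigenval0 // addrC addKr /kappa bin0 expn0 muln1 expr1.
  by rewrite powRN powR12_sqrt ?sqr_ge0 // sqrtr_sqr gtr0_norm ?mul1r.
apply: eq_bigr => i _; rewrite -powR_mulrn ?powR_ge0 // -powRrM.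
by congr (_ `^ _); rewrite mulrC mulrN mulNr.
Qed.

Lemma partition_functionE (beta : R) : 0 < beta ->
  partition_function d n.+1 J m beta =
  ((2 * pi / beta) `^ ((n.+1 ^ d)%N%:R / 2) *
   \prod_(y : X) (1 + m ^+ 2 - eigenval d n.+1 J (hweight y)) `^ (- 2^-1))%:E.
Proof.
(* Absorbing beta into the matrix makes -beta H equal to -1/2 times the form of [M]. *)
move=> beta0; pose f (x y : X) := beta * coupling x y.
pose M := \matrix_(i < #|X|, j < #|X|) f (enum_val i) (enum_val j).
have qformE (u : 'I_#|X| -> R) : qform M u =
    beta * \sum_x \sum_y coupling x y * u (enum_rank x) * u (enum_rank y).
  rewrite mulr_sumr [RHS]big_enum_valT; apply: eq_bigr => i _.
  rewrite mulr_sumr [RHS]big_enum_valT; apply: eq_bigr => j _.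
  by rewrite !enum_valK mxE /f !mulrA.
have Msym i j : M i j = M j i by rewrite !mxE /f coupling_sym.
have Mpos : posdef M.
  move=> u [i ui]; rewrite qformE mulr_gt0 // coupling_gt0 //.
  by exists (enum_val i); rewrite enum_valK.
have [_ IM] := integral_gauss M Msym Mpos.
rewrite /partition_function.
transitivity (\int[@lebesgue_tuple R #|X|]_t
    (expR (- 2^-1 * qform M (fun i => tnth t i)))%:E)%E.
  apply: eq_integral => t _; congr ((expR _)%:E).
  by rewrite hamiltonian_coupling // qformE; ring.
rewrite IM; congr (_%:E).
have cardX : #|X| = (n.+1 ^ d)%N by rewrite card_ffun !card_ord.
pose ev (y : X) := beta * (1 + m ^+ 2 - eigenval d n.+1 J (hweight y)).
have -> : \det M = \prod_y ev y.
  apply: (@det_eigenbasis _ _ f hbasis hdual); last exact: hbasis_dual.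
  move=> x y; rewrite /f; under eq_bigr do rewrite -mulrA.
  by rewrite -mulr_sumr coupling_hbasis mulrCA.
rewrite powR_prod; last first.
  by move=> y; rewrite mulr_ge0 ?ltW ?coupling_eigenval_gt0.
(* Each eigenvalue releases a factor beta^(-1/2); together they turn (2 pi)^(|X|/2) into (2 pi /
   beta)^(|X|/2). *)
rewrite /ev; under eq_bigr do rewrite powRM ?ltW ?coupling_eigenval_gt0 //.
rewrite big_split /= prodr_const cardX mulrA; congr (_ * _).
rewrite (@powRM _ (2 * pi)) ?invr_ge0 ?mulr_ge0 ?pi_ge0 ?(ltW beta0) //.
congr (_ * _).
rewrite -powR_mulrn ?powR_ge0 // -powRrM -(powR_inv1 (ltW beta0)) -powRrM.
by congr (_ `^ _); ring.
Qed.

End free_field.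

Theorem proposition3p2 (R : realType) (d n : nat) (m beta : R) (J : nat -> R)
  (hd : (2 <= d)%N) (hn : (2 <= n)%N) (hm : 0 < m) (hbeta : 0 < beta)
  (hJ : forall i : nat, (1 <= i <= d)%N -> 0 <= J i)
  (hJ1 : \sum_(1 <= i < d.+1) (kappa d n i)%:R * J i <= 1) :
  partition_function d n J m beta =
  ((2 * pi / beta) `^ ((n ^ d)%N%:R / 2) * (1 / m) *
   \prod_(1 <= i < d.+1)
      (1 + m ^+ 2 - eigenval d n J i) `^ (- (kappa d n i)%:R / 2))%:E.
Proof.
(* With the alphabet size written as n + 1, the bound 2 <= n + 1 reads 0 < n. *)
case: n hn hJ1 => [//|n] n_gt0 _.
by rewrite partition_functionE // prod_coupling_eigenval // mulrA.
Qed.
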